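(* There exists a planar graph $G$ with $\chi_2(G)=20$.
   Context: A signified graph $(G,\Sigma)$ is a simple graph $G$ with a set $\Sigma\subseteq E(G)$ of negative edges, other edges positive. A signified homomorphism of $(G,\Sigma)$ to $(H,\Lambda)$ is a map $V(G)\to V(H)$ sending every edge to an edge of the same sign. $\chi_2(G,\Sigma)$ is the minimum number of vertices of a signified graph to which $(G,\Sigma)$ admits a signified homomorphism, and $\chi_2(G)=\max_{\Sigma\subseteq E(G)}\chi_2(G,\Sigma)$. *)

(* Defs.v *)
From mathcomp Require Import all_boot.
From Stdlib Require Import Reals.

Set Implicit Arguments.
Unset Strict Implicit.
Unset Printing Implicit Defensive.

Definition simple_graph (T : finType) (adj : rel T) : Prop :=
  symmetric adj /\ irreflexive adj.

Definition in01 (t : R) : Prop := (0 <= t <= 1)%R.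

Definition cont01 (g : R -> R * R) : Prop :=
  forall t, in01 t -> forall eps, (0 < eps)%R ->
    exists delta, (0 < delta)%R /\
      forall s, in01 s -> (Rabs (s - t) < delta)%R ->
        (Rabs (fst (g s) - fst (g t)) < eps)%R /\
        (Rabs (snd (g s) - snd (g t)) < eps)%R.

Definition inj01 (g : R -> R * R) : Prop :=
  forall s t, in01 s -> in01 t -> g s = g t -> s = t.

Definition planar_drawing (T : finType) (adj : rel T)
    (pos : T -> R * R) (arc : T -> T -> R -> R * R) : Prop :=
  injective pos /\
  (forall x y, adj x y ->
     cont01 (arc x y) /\ inj01 (arc x y) /\
     arc x y 0%R = pos x /\ arc x y 1%R = pos y /\
     (forall t, in01 t -> arc y x t = arc x y (1 - t)%R) /\
     (forall t z, (0 < t < 1)%R -> arc x y t <> pos z)) /\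
  (forall x y u v s t, adj x y -> adj u v ->
     ~ ((x = u /\ y = v) \/ (x = v /\ y = u)) ->
     in01 s -> in01 t -> arc x y s = arc u v t ->
     exists z, (z = x \/ z = y) /\ (z = u \/ z = v) /\ arc x y s = pos z).

Definition planar (T : finType) (adj : rel T) : Prop :=
  exists pos arc, @planar_drawing T adj pos arc.

(* A signature on G is encoded by a symmetric relation sigma : rel T;
   the set of negative edges is Sigma = {xy in E(G) | sigma x y}
   (values of sigma on non-edges are irrelevant). Every Sigma ⊆ E(G)
   arises this way. *)

Definition signified_hom (T U : finType) (adjG sigma : rel T)
    (adjH lambda : rel U) (f : T -> U) : Prop :=
  forall x y, adjG x y -> adjH (f x) (f y) /\ lambda (f x) (f y) = sigma x y.

Definition hom_to_order (T : finType) (adjG sigma : rel T) (n : nat) : Prop :=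
  exists (adjH lambda : rel 'I_n) (f : T -> 'I_n),
    simple_graph adjH /\ symmetric lambda /\
    signified_hom adjG sigma adjH lambda f.

Definition chi2_sig_eq (T : finType) (adjG sigma : rel T) (k : nat) : Prop :=
  hom_to_order adjG sigma k /\
  forall m, hom_to_order adjG sigma m -> k <= m.

Definition chi2_eq (T : finType) (adjG : rel T) (k : nat) : Prop :=
  (forall sigma : rel T, symmetric sigma ->
     exists k', chi2_sig_eq adjG sigma k' /\ k' <= k) /\
  (exists sigma : rel T, symmetric sigma /\ chi2_sig_eq adjG sigma k).

(* Main.v *)
(* For a graph A let its apex graph be a new vertex joined positively to one copy
   of A and negatively to another. The signs seen from the new vertex separate
   the colours of the two copies, so if A needs n colours, its apex graph needs
   2n+1. The path with signs + - + - needs 4 colours, hence two apex steps give a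
   planar graph B needing 19. Glue a copy of B by its root to every vertex of B:
   with only 19 colours, every colour would have exactly 9 positive and 9
   negative neighbours, contradicting the handshake lemma. Conversely any
   signature of this graph maps to the Tromp graph of Paley(9), on 20 vertices,
   because there every triangle has a common neighbour with any prescribed
   signs and the graph is built by adding vertices joined to cliques of size at
   most 3. *)
Require Import Defs.
From mathcomp Require Import all_boot.
From Stdlib Require Import Reals.
From Stdlib Require Import ZArith Lra Lia Classical.

Set Implicit Arguments.
Unset Strict Implicit.
Unset Printing Implicit Defensive.

(** * Apex graphs, rooted products and alternating paths *)

Definition apex (T : finType) (adj : rel T) : rel (option (T + T)) :=
  fun x y => match x, y with
  | None, Some _ | Some _, None => true
  | Some (inl a), Some (inl b) | Some (inr a), Some (inr b) => adj a b
  | _, _ => false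
  end.

(** The value [true] marks a negative edge, so the left copy is the one joined negatively. *)
Definition apex_sign (T : finType) (sg : rel T) : rel (option (T + T)) :=
  fun x y => match x, y with
  | None, Some (inl _) | Some (inl _), None => true
  | Some (inl a), Some (inl b) | Some (inr a), Some (inr b) => sg a b
  | _, _ => false
  end.

(** In [(i, j)], [i] tells at which base vertex the copy hangs and [j] is the place in that copy;
    the pairs [(i, r)] form the base graph. *)
Definition rooted_product (T : finType) (adj : rel T) (r : T) : rel (T * T) :=
  fun p q => (p.1 == q.1) && adj p.2 q.2
          || [&& p.2 == r, q.2 == r & adj p.1 q.1].

Definition rooted_product_sign (T : finType) (sg : rel T) : rel (T * T) :=
  fun p q => if p.1 == q.1 then sg p.2 q.2 else sg p.1 q.1.

Definition path_adj (n : nat) : rel 'I_n :=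
  fun i j => (i.+1 == j) || (j.+1 == i).
Arguments path_adj : clear implicits.

Definition path_sign (n : nat) : rel 'I_n := fun i j => odd (minn i j).
Arguments path_sign : clear implicits.

Lemma simple_apex (T : finType) (adj : rel T) :
  simple_graph adj -> simple_graph (apex adj).
Proof.
move=> [sym irr]; split; first by move=> [[a|a]|] [[b|b]|] //=; apply: sym.
by move=> [[a|a]|] //=; apply: irr.
Qed.

Lemma apex_sign_sym (T : finType) (sg : rel T) :
  symmetric sg -> symmetric (apex_sign sg).
Proof. by move=> sym [[a|a]|] [[b|b]|] //=; apply: sym. Qed.

Lemma simple_rooted_product (T : finType) (adj : rel T) (r : T) :
  simple_graph adj -> simple_graph (rooted_product adj r).
Proof.
move=> [sym irr]; split=> [p q|p]; rewrite /rooted_product.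
  by rewrite eq_sym sym (sym p.1) andbCA.
by rewrite !irr !andbF.
Qed.

Lemma rooted_product_sign_sym (T : finType) (sg : rel T) :
  symmetric sg -> symmetric (rooted_product_sign sg).
Proof.
by move=> sym p q; rewrite /rooted_product_sign eq_sym sym (sym p.1).
Qed.

Lemma simple_path n : simple_graph (path_adj n).
Proof.
split=> [i j|i]; rewrite /path_adj; first by rewrite orbC.
by rewrite orbb gtn_eqF.
Qed.

Lemma path_sign_sym n : symmetric (path_sign n).
Proof. by move=> i j; rewrite /path_sign minnC. Qed.

(** * Lower bound *)

(** Colours are counted in the image and not in the target, because both copies inside an apex graph
    are mapped to one common target. *)
Definition uses_colors (T : finType) (adj sg : rel T) (n : nat) : Prop :=
  forall (U : finType) (adjH lam : rel U) (f : T -> U),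
    simple_graph adjH -> symmetric lam -> signified_hom adj sg adjH lam f ->
    n <= #|[set f x | x : T]|.

Definition sign_nbrs (U : finType) (adjH lam : rel U) (b : bool) (c : U) :=
  [set u | adjH c u & lam c u == b].

(* With at most three colours, + - + - forces a signed triangle one of whose
   corners misses a sign required by the path. *)
Lemma path_uses_colors : uses_colors (path_adj 5) (path_sign 5) 4.
Proof.
move=> U adjH lam f [symH irrH] symlam homf.
pose v (k : nat) (hk : k < 5) : 'I_5 := Ordinal hk.
have [a01 l01] := homf (@v 0 isT) (@v 1 isT) isT.
have [a12 l12] := homf (@v 1 isT) (@v 2 isT) isT.
have [a23 l23] := homf (@v 2 isT) (@v 3 isT) isT.
have [a34 l34] := homf (@v 3 isT) (@v 4 isT) isT.
rewrite /path_sign /= in l01 l12 l23 l34.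
set f0 := f (@v 0 isT) in a01 l01 *; set f1 := f (@v 1 isT) in a01 l01 a12 l12 *.
set f2 := f (@v 2 isT) in a12 l12 a23 l23 *.
set f3 := f (@v 3 isT) in a23 l23 a34 l34 *; set f4 := f (@v 4 isT) in a34 l34 *.
have neq x y : adjH x y -> x != y by apply: contraTneq => ->; rewrite irrH.
(* Two edges of opposite sign at a common colour have distinct other ends. *)
have n02 : f0 != f2 by apply/eqP=> e; move: l12; rewrite -e symlam l01.
have n13 : f1 != f3 by apply/eqP=> e; move: l23; rewrite -e symlam l12.
have n24 : f2 != f4 by apply/eqP=> e; move: l34; rewrite -e symlam l23.
have im i : f i \in [set f x | x : 'I_5] by apply: imset_f.
have four x y z t : uniq [:: x; y; z; t] ->
  all (fun u => u \in [set f x | x : 'I_5]) [:: x; y; z; t] ->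
  4 <= #|[set f x | x : 'I_5]|.
  move=> un al; rewrite cardE.
  by apply: (uniq_leq_size un) => u /(allP al); rewrite mem_enum.
have n01 := neq _ _ a01; have n12 := neq _ _ a12.
have n23 := neq _ _ a23; have n34 := neq _ _ a34.
have [e03|n03] := eqVneq f0 f3; last first.
  apply: (four f0 f1 f2 f3); last by rewrite /= !im.
  by rewrite /= !inE !negb_or n01 n02 n03 n12 n13 n23.
apply: (four f0 f1 f2 f4); last by rewrite /= !im.
have n14 : f1 != f4 by apply/eqP=> e; move: l34; rewrite -e -e03 l01.
by rewrite /= !inE !negb_or n01 n02 e03 n34 n12 n14 n24.
Qed.

(** Take for [A] the colours of the copy joined to the apex with sign [b]. *)
Lemma apex_sign_nbrs (T : finType) (adj sg : rel T) (n : nat) (U : finType)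
    (adjH lam : rel U) (f : option (T + T) -> U) (b : bool) :
  uses_colors adj sg n -> simple_graph adjH -> symmetric lam ->
  signified_hom (apex adj) (apex_sign sg) adjH lam f ->
  exists2 A : {set U}, n <= #|A| &
    A \subset sign_nbrs adjH lam b (f None) :&: [set f x | x : option (T + T)].
Proof.
move=> usesn simH symlam homf.
pose g (x : T) := Some (if b then inl x else inr x) : option (T + T).
exists [set f (g x) | x : T].
  apply: (usesn U adjH lam) => // x y xy.
  by rewrite /g; case: (b); apply: homf.
apply/subsetP=> _ /imsetP[x _ ->]; rewrite !inE imset_f // andbT.
have [-> ->] : adjH (f None) (f (g x)) /\ lam (f None) (f (g x)) = b.
  by have := homf None (g x) isT; rewrite /g; case: (b).
exact/eqxx.
Qed.

(** The extra colour is that of the apex: the target has no loops, so it occurs in neither copy. *)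
Lemma apex_uses_colors (T : finType) (adj sg : rel T) (n : nat) :
  uses_colors adj sg n -> uses_colors (apex adj) (apex_sign sg) (n + n).+1.
Proof.
move=> usesn U adjH lam f simH symlam homf.
have [A nA] := apex_sign_nbrs true usesn simH symlam homf.
have [B nB] := apex_sign_nbrs false usesn simH symlam homf.
rewrite !subsetI => /andP[sB imB] /andP[sA imA].
have dAB : [disjoint A & B].
  apply/pred0P=> u /=; apply/negP=> /andP[/(subsetP sA) uA /(subsetP sB)].
  by move: uA; rewrite !inE => /andP[_ /eqP ->] /andP[].
have dN : f None \notin A :|: B.
  rewrite inE; apply/orP=> -[/(subsetP sA)|/(subsetP sB)];
  by rewrite !inE simH.2.
have : f None |: (A :|: B) \subset [set f x | x : option (T + T)].
  by rewrite !subUset imA imB sub1set imset_f.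
move/subset_leq_card; apply: leq_trans.
rewrite cardsU1 dN add1n ltnS cardsU disjoint_setI0 // cards0 subn0.
exact: leq_add.
Qed.

Lemma sum_degrees_even (m : nat) (r : rel 'I_m) :
  symmetric r -> irreflexive r -> ~~ odd (\sum_(i < m) #|[set j | r i j]|).
Proof.
move=> symr irr.
(* Split the ordered pairs into those with [i < j] and those with [j < i]; by symmetry both halves
   have the same sum. *)
have -> : \sum_(i < m) #|[set j | r i j]| =
    \sum_(i < m) \sum_(j < m | i < j) r i j +
    \sum_(i < m) \sum_(j < m | j < i) r i j.
  rewrite -big_split; apply: eq_bigr => i _ /=.
  rewrite cardsE -sum1_card big_mkcond (bigID (fun j : 'I_m => i < j)) /=.
  congr (_ + _).
  rewrite (bigID (fun j : 'I_m => j < i)) /= [X in _ + X]big1 ?addn0.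
    rewrite (eq_bigl (fun j : 'I_m => j < i)) => [|j]; last by case: ltngtP.
    exact: eq_bigr.
  move=> j; rewrite -!leqNgt -eqn_leq => /eqP/val_inj ->.
  by rewrite -topredE /= irr.
have -> : \sum_(i < m) \sum_(j < m | j < i) r i j =
    \sum_(i < m) \sum_(j < m | i < j) r i j.
  rewrite (exchange_big_dep xpredT) //=; apply: eq_bigr => i _.
  by apply: eq_bigr => j _; rewrite symr.
by rewrite addnn odd_double.
Qed.

(* In 2n+1 colours every colour would have exactly n neighbours of each sign,
   which is impossible for odd n by the handshake lemma. *)
Lemma rooted_product_uses_colors (T : finType) (adj sg : rel T) (n m : nat) :
  odd n -> simple_graph adj -> uses_colors adj sg n ->
  hom_to_order (rooted_product (apex adj) None)
    (rooted_product_sign (apex_sign sg)) m ->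
  (n + n).+2 <= m.
Proof.
move=> oddn simT usesn [adjH [lam [f [simH [symlam homf]]]]].
have [symH irrH] := simH.
pose g i := f (i, None).
have homg : signified_hom (apex adj) (apex_sign sg) adjH lam g.
  move=> x y xy; have := homf (x, None) (y, None).
  rewrite /rooted_product /rooted_product_sign /= xy orbT => /(_ isT).
  by case: eqVneq xy => // ->; rewrite (simple_apex simT).2.
have homc i : signified_hom (apex adj) (apex_sign sg) adjH lam
    (fun j => f (i, j)).
  move=> x y xy; have := homf (i, x) (i, y).
  by rewrite /rooted_product /rooted_product_sign /= eqxx xy; apply.
have lem := apex_uses_colors usesn simH symlam homg.
have lim : #|[set g x | x : option (T + T)]| <= m.
  by rewrite -[X in _ <= X]card_ord max_card.
rewrite ltn_neqAle (leq_trans lem lim) andbT.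
apply/eqP=> em.
(* If m = 2n+1, the base copy already uses every colour, so every colour is the root colour of some
   hung copy. *)
have onto u : u \in [set g x | x : option (T + T)].
  have /eqP -> : [set g x | x : option (T + T)] == setT.
    by rewrite eqEcard subsetT cardsT card_ord -[X in X <= _]em.
  by rewrite inE.
have deg u : #|[set j | adjH u j && lam u j]| = n.
  have nb b : n <= #|sign_nbrs adjH lam b u|.
    have /imsetP[i _ ->] := onto u.
    have [A nA sA] := apex_sign_nbrs b usesn simH symlam (homc i).
    apply: leq_trans nA (subset_leq_card _).
    by apply: subset_trans sA _; apply: subsetIl.
  have -> : [set j | adjH u j && lam u j] = sign_nbrs adjH lam true u.
    by apply/setP=> j; rewrite !inE eqb_id.
  apply/eqP; rewrite eqn_leq nb andbT.
  have dj : [disjoint sign_nbrs adjH lam true u & sign_nbrs adjH lam false u].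
    apply/pred0P=> j; rewrite /= !inE.
    by case: (lam u j); rewrite ?andbF.
  have un : u \notin sign_nbrs adjH lam true u :|: sign_nbrs adjH lam false u.
    by rewrite !inE irrH.
  (* The colour [u] and its neighbours of both signs fit into 2n+1 colours, and each sign has at
     least n neighbours. *)
  have := max_card (mem (u |: (sign_nbrs adjH lam true u
                                :|: sign_nbrs adjH lam false u))).
  rewrite cardsU1 un add1n cardsU disjoint_setI0 // cards0 subn0 card_ord.
  rewrite -[X in _ <= X]em.
  rewrite ltnS => h; rewrite -(leq_add2r n); apply: leq_trans h.
  by rewrite leq_add2l.
(* The negative edges form an n-regular graph on 2n+1 vertices, with both numbers odd. *)
pose r i j := adjH i j && lam i j.
have symr : symmetric r by move=> i j; rewrite /r symH symlam.
have irr : irreflexive r by move=> i; rewrite /r irrH.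
have oddm : odd m by rewrite -em /= addnn odd_double.
have := sum_degrees_even symr irr.
rewrite (eq_bigr (fun=> n)) => [|i _]; last exact: deg.
by rewrite sum_nat_const card_ord oddM oddm oddn.
Qed.

(** * Upper bound *)

Definition constraint_ok (U : finType) (adjH lam : rel U) (d : U)
    (c : U * bool) : bool :=
  adjH c.1 d && (lam c.1 d == c.2).

Definition clique (U : finType) (adjH : rel U) (cs : seq (U * bool)) : bool :=
  pairwise (fun c c' => adjH c.1 c'.1) cs.

Definition extendable (U : finType) (adjH lam : rel U) (k : nat) : Prop :=
  forall cs, size cs <= k -> clique adjH cs ->
    exists d, all (constraint_ok adjH lam d) cs.

(* Vertex x of T has to be joined to the colours cs with the signs s x. *)
Definition clique_colorable (U : finType) (adjH lam : rel U) (k : nat)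
    (T : finType) (adj : rel T) : Prop :=
  forall (sg : rel T) (cs : seq U) (s : T -> seq bool),
    symmetric sg -> size cs <= k -> pairwise adjH cs ->
    (forall x, size (s x) = size cs) ->
    exists2 f, signified_hom adj sg adjH lam f
             & forall x, all (constraint_ok adjH lam (f x)) (zip cs (s x)).

Lemma clique_zip (U : finType) (adjH : rel U) (cs : seq U) (s : seq bool) :
  size s = size cs -> clique adjH (zip cs s) = pairwise adjH cs.
Proof.
by move=> szs; rewrite -[in RHS](@unzip1_zip _ _ cs s) ?szs // pairwise_map.
Qed.

(** Colour greedily along the path: a new vertex is constrained only by the clique and by its
    predecessor. *)
Lemma path_clique_colorable (U : finType) (adjH lam : rel U) (k n : nat) :
  symmetric adjH -> symmetric lam -> extendable adjH lam k.+1 ->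
  clique_colorable adjH lam k (path_adj n).
Proof.
move=> symH symlam ext sg cs s symsg szcs clq szs.
(* Signs and constraints are extended to all naturals for the induction. The default list has the
   length of [cs], since [g] is also constrained at [n], past the last vertex. *)
pose e (i j : nat) := match insub i, insub j with
  | Some i', Some j' => sg i' j' | _, _ => false end.
pose t (i : nat) := if insub i is Some i' then s i' else nseq (size cs) true.
have szt i : size (t i) = size cs.
  by rewrite /t; case: insubP => [i' _ _|_]; rewrite ?szs ?size_nseq.
have [g gt ge] : exists2 g : nat -> U,
    forall i, i <= n -> all (constraint_ok adjH lam (g i)) (zip cs (t i))
  & forall i, i < n -> constraint_ok adjH lam (g i.+1) (g i, e i i.+1).
  elim: (n) => [|m [g gt ge]].
    have [||d dP] := ext (zip cs (t 0)); last by exists (fun=> d) => // -[].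
      by rewrite size_zip szt minnn ltnW.
    by rewrite clique_zip.
  have [||d /andP[d1 d2]] := ext ((g m, e m m.+1) :: zip cs (t m.+1)).
  - by rewrite /= size_zip szt minnn.
  - rewrite /clique /= -/(clique _ _) clique_zip // clq andbT.
    (* The previous colour met its own constraints, hence is adjacent to all of [cs] and enlarges
       the clique. *)
    have := gt m (leqnn m); move: (szt m) (szt m.+1).
    elim: (cs) (t m) (t m.+1) => [|c cs' IH] [|b bs] [|b' bs'] //= [sz] [sz'].
    by move=> /andP[/andP[cg _] /IH ->] //; rewrite symH cg.
  exists (fun i => if i <= m then g i else d) => i.
    by rewrite leq_eqVlt ltnS => /predU1P[->|im]; rewrite ?ltnn // im gt.
  rewrite ltnS => im; rewrite im; case: ltnP => [/ge //|mi].
  by have -> : i = m by apply/eqP; rewrite eqn_leq im.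
exists (fun i : 'I_n => g i) => [|i]; last first.
  by have := gt i (ltnW (ltn_ord i)); rewrite /t valK.
have step (i j : 'I_n) : i.+1 = j ->
    adjH (g i) (g j) /\ lam (g i) (g j) = sg i j.
  move=> ij; have := ge i (ltn_ord i).
  by rewrite /e ij !valK /constraint_ok /= => /andP[-> /eqP ->].
move=> i j /orP[/eqP/step //|/eqP/step[]].
by rewrite symH symlam symsg.
Qed.

(** Once the root has colour [d], each copy is coloured separately against the clique [d :: cs].
    Leaving [d] to the caller allows a copy to be glued to a vertex already coloured. *)
Lemma apex_clique_colorable_root (U : finType) (adjH lam : rel U) (k : nat)
    (T : finType) (adj : rel T) (sg : rel (option (T + T))) (cs : seq U)
    (s : option (T + T) -> seq bool) (d : U) :
  symmetric adjH -> symmetric lam -> clique_colorable adjH lam k.+1 adj ->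
  symmetric sg -> size cs <= k -> pairwise adjH cs ->
  (forall x, size (s x) = size cs) ->
  all (constraint_ok adjH lam d) (zip cs (s None)) ->
  exists f, [/\ signified_hom (apex adj) sg adjH lam f,
    forall x, all (constraint_ok adjH lam (f x)) (zip cs (s x)) & f None = d].
Proof.
move=> symH symlam col symsg szcs clq szs dP.
have clqd : pairwise adjH (d :: cs).
  rewrite /= clq andbT; move: dP (szs None).
  elim: (cs) (s None) => [|c cs' IH] [|b bs] //= /andP[/andP[cd _] /IH h] [/h].
  by rewrite symH cd => ->.
have colg (g : T -> option (T + T)) : exists2 f,
    signified_hom adj (fun x y => sg (g x) (g y)) adjH lam f
  & forall x, all (constraint_ok adjH lam (f x))
                (zip (d :: cs) (sg None (g x) :: s (g x))).
  by apply: col => // x; rewrite /= szs.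
have [fl homl fls] := colg (fun x => Some (inl x)).
have [fr homr frs] := colg (fun x => Some (inr x)).
exists (fun x => match x with
  | None => d | Some (inl a) => fl a | Some (inr a) => fr a end).
split=> //; last first.
  by case=> [[a|a]|] //; [have /andP[] := fls a | have /andP[] := frs a].
have hl a : adjH d (fl a) /\ lam d (fl a) = sg None (Some (inl a)).
  by have /andP[/andP[-> /eqP]] := fls a.
have hr a : adjH d (fr a) /\ lam d (fr a) = sg None (Some (inr a)).
  by have /andP[/andP[-> /eqP]] := frs a.
move=> [[a|a]|] [[b|b]|] //= ab.
- exact: homl.
- by rewrite symH symlam symsg; apply: hl.
- exact: homr.
- by rewrite symH symlam symsg; apply: hr.
Qed.

Lemma apex_clique_colorable (U : finType) (adjH lam : rel U) (k : nat)
    (T : finType) (adj : rel T) :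
  symmetric adjH -> symmetric lam -> extendable adjH lam k ->
  clique_colorable adjH lam k.+1 adj -> clique_colorable adjH lam k (apex adj).
Proof.
move=> symH symlam ext col sg cs s symsg szcs clq szs.
have [||d dP] := ext (zip cs (s None)).
- by rewrite size_zip szs minnn.
- by rewrite clique_zip.
have [f [homf fs _]] :=
  apex_clique_colorable_root symH symlam col symsg szcs clq szs dP.
by exists f.
Qed.

(** Colour the base copy first, then each hung copy with its root colour prescribed by the base. *)
Lemma rooted_product_hom (U : finType) (adjH lam : rel U) (T : finType)
    (adj : rel T) (sg : rel (option (T + T) * option (T + T))) (u : U) :
  symmetric adjH -> symmetric lam -> simple_graph adj ->
  clique_colorable adjH lam 1 adj -> symmetric sg ->
  exists f, signified_hom (rooted_product (apex adj) None) sg adjH lam f.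
Proof.
move=> symH symlam simT col symsg.
have rooted (g : option (T + T) -> option (T + T) * option (T + T)) d :
    exists f, signified_hom (apex adj) (fun x y => sg (g x) (g y)) adjH lam f
              /\ f None = d.
  have [f [homf _ fd]] := @apex_clique_colorable_root U adjH lam 0 T adj
    (fun x y => sg (g x) (g y)) [::] (fun=> [::]) d symH symlam col
    (fun x y => symsg _ _) isT isT (fun=> erefl) isT.
  by exists f.
have [h [homh _]] := rooted (fun x => (x, None)) u.
have /fin_all_exists[F FP] i := rooted (fun x => (i, x)) (h i).
exists (fun p => F p.1 p.2) => -[i x] [j y].
rewrite /rooted_product /= => /orP[/andP[/eqP <- xy]|].
  exact: (FP i).1.
case/and3P=> /eqP -> /eqP -> ij.
by rewrite (FP i).2 (FP j).2; apply: homh.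
Qed.

(* The Tromp graph of Paley(9), with Paley(9) drawn as the 3 x 3 rook's graph
   on 0..8 and 9 as the added vertex of constant sign; antitwins differ in the
   second component. *)
Definition paley9_sign (x y : nat) : bool :=
  [|| x == 9, y == 9, x %/ 3 == y %/ 3 | x %% 3 == y %% 3].

Definition tromp_adj : rel ('I_10 * bool) := fun p q => p.1 != q.1.

Definition tromp_sign : rel ('I_10 * bool) :=
  fun p q => paley9_sign p.1 q.1 (+) p.2 (+) q.2.

Lemma tromp_adj_simple : simple_graph tromp_adj.
Proof.
by split=> [p q|p]; rewrite /tromp_adj ?eqxx // eq_sym.
Qed.

Lemma tromp_sign_sym : symmetric tromp_sign.
Proof.
move=> p q; rewrite /tromp_sign /paley9_sign orbCA.
rewrite (eq_sym (p.1 %/ 3)) (eq_sym (p.1 %% 3)) -!addbA.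
by rewrite (addbC p.2).
Qed.

(* Coinciding x, y, z are allowed so as to cover smaller cliques. *)
Lemma paley9_extend (x y z : 'I_10) (a b : bool) :
  (x = y -> a = false) -> (x = z -> b = false) -> (y = z -> a = b) ->
  exists w : 'I_10, [/\ x != w, y != w, z != w,
    paley9_sign x w (+) paley9_sign y w = a &
    paley9_sign x w (+) paley9_sign z w = b].
Proof.
pose P x y z a b w := [&& x != w, y != w, z != w,
  paley9_sign x w (+) paley9_sign y w == a &
  paley9_sign x w (+) paley9_sign z w == b].
(* A boolean form of the claim over natural numbers, which is settled by evaluating all cases. *)
pose Q x y z a b := [|| (x == y) && a, (x == z) && b, (y == z) && (a != b) |
  has (P x y z a b) (iota 0 10)].
have all_io n (p : pred nat) : all p (iota 0 n) -> forall i : 'I_n, p i.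
  by move=> /allP h i; apply: h; rewrite mem_iota ltn_ord.
have : all (fun x => all (fun y => all (fun z =>
    [&& Q x y z true true, Q x y z true false, Q x y z false true &
        Q x y z false false]) (iota 0 10)) (iota 0 10)) (iota 0 10).
  by vm_compute.
move=> /all_io/(_ x)/all_io/(_ y)/all_io/(_ z) q xy xz yz.
have /or4P[|||/hasP[w]] : Q x y z a b by case: (a) (b) q => [] [] /and4P[].
- by case/andP=> /eqP/val_inj/xy ->.
- by case/andP=> /eqP/val_inj/xz ->.
- by case/andP=> /eqP/val_inj/yz ->; rewrite eqxx.
rewrite mem_iota /= => w10 /and5P[? ? ? /eqP ? /eqP ?].
by exists (Ordinal w10).
Qed.

(** Switching to the antitwin flips all three signs, so only two sums of signs constrain the first
    component [w]; the second component then fixes the first sign. *)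
Lemma tromp_extendable : extendable tromp_adj tromp_sign 3.
Proof.
(* Repeated entries are allowed, so that a smaller clique is padded to three. *)
have ext3 (c1 c2 c3 : 'I_10 * bool * bool) :
    (tromp_adj c1.1 c2.1 || (c1 == c2)) -> (tromp_adj c1.1 c3.1 || (c1 == c3)) ->
    (tromp_adj c2.1 c3.1 || (c2 == c3)) ->
    exists d, all (constraint_ok tromp_adj tromp_sign d) [:: c1; c2; c3].
  move: c1 c2 c3 => [[x sx] a] [[y sy] b] [[z sz] c]; rewrite /tromp_adj /=.
  move=> xy xz yz.
  have [|||w [nx ny nz ey ez]] :=
    @paley9_extend x y z (sx (+) sy (+) a (+) b) (sx (+) sz (+) a (+) c).
  - by move=> e; move: xy; rewrite e eqxx => /eqP[-> ->]; rewrite addbb addFb addbb.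
  - by move=> e; move: xz; rewrite e eqxx => /eqP[-> ->]; rewrite addbb addFb addbb.
  - by move=> e; move: yz; rewrite e eqxx => /eqP[-> ->].
  exists (w, paley9_sign x w (+) sx (+) a).
  rewrite /constraint_ok /tromp_adj /tromp_sign /= nx ny nz /=.
  move: ey ez; case: (paley9_sign x w); case: (paley9_sign y w);
  case: (paley9_sign z w); move: a b c sx sy sz {xy xz yz};
  by do 6![case].
case=> [|c1 [|c2 [|c3 [|//]]]] /= _.
- by exists (ord0, true).
- move=> _; have [||| d /and4P[d1 _ _ _]] := ext3 c1 c1 c1;
    rewrite ?eqxx ?orbT //.
  by exists d; rewrite d1.
- rewrite /clique /= !andbT => c12.
  have [||| d /and4P[d1 d2 _ _]] := ext3 c1 c2 c2; rewrite ?c12 ?eqxx ?orbT //.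
  by exists d; rewrite d1 d2.
- rewrite /clique /= !andbT => /andP[/andP[c12 c13] c23].
  by apply: ext3; rewrite ?c12 ?c13 ?c23.
Qed.

Lemma signified_hom_to_order (T U : finType) (adj sg : rel T)
    (adjH lam : rel U) (f : T -> U) :
  simple_graph adjH -> symmetric lam -> signified_hom adj sg adjH lam f ->
  hom_to_order adj sg #|U|.
Proof.
move=> [symH irrH] symlam homf.
exists (fun i j => adjH (enum_val i) (enum_val j)).
exists (fun i j => lam (enum_val i) (enum_val j)), (fun x => enum_rank (f x)).
split; first by split=> [i j|i]; [apply: symH | apply: irrH].
split=> [i j|x y xy]; first exact: symlam.
by rewrite !enum_rankK; apply: homf.
Qed.

Lemma chi2_sig_exists (T : finType) (adj sg : rel T) (n : nat) :
  hom_to_order adj sg n -> exists k, chi2_sig_eq adj sg k /\ k <= n.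
Proof.
elim/ltn_ind: n => n IH homn.
have [[m mn homm]|min] := classic (exists2 m, m < n & hom_to_order adj sg m).
  have [k [chik km]] := IH m mn homm.
  by exists k; split=> //; apply: leq_trans km (ltnW mn).
exists n; split=> //; split=> // m homm.
by rewrite leqNgt; apply/negP=> mn; apply: min; exists m.
Qed.

(** * Straight-line drawings *)

Local Open Scope R_scope.

Definition lerp (P Q : R * R) (t : R) : R * R :=
  ((1 - t) * P.1 + t * Q.1, (1 - t) * P.2 + t * Q.2).

Definition straight_drawing (T : finType) (adj : rel T) (pos : T -> R * R) :
    Prop :=
  injective pos /\
  forall x y u v s t, adj x y -> adj u v ->
    ~ ((x = u /\ y = v) \/ (x = v /\ y = u)) ->
    in01 s -> in01 t -> lerp (pos x) (pos y) s = lerp (pos u) (pos v) t ->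
    exists z, (z = x \/ z = y) /\ (z = u \/ z = v)
              /\ lerp (pos x) (pos y) s = pos z.

Lemma lerp0 P Q : lerp P Q 0 = P.
Proof. by case: P => a b; rewrite /lerp /=; congr pair; lra. Qed.

Lemma lerp1 P Q : lerp P Q 1 = Q.
Proof. by case: Q => a b; rewrite /lerp /=; congr pair; lra. Qed.

Lemma lerp_sym P Q t : lerp Q P t = lerp P Q (1 - t).
Proof. by rewrite /lerp /=; congr pair; lra. Qed.

Lemma lerp_inj P Q s t : P <> Q -> lerp P Q s = lerp P Q t -> s = t.
Proof.
case: P Q => [a b] [c d] PQ [e1 e2].
have [//|] := Req_dec s t.
case: (Req_dec a c) => [ac|ac]; last first.
  move=> _; apply: (Rmult_eq_reg_r (c - a)); lra.
case: (Req_dec b d) => [bd|bd]; first by case: PQ; rewrite ac bd.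
by move=> _; apply: (Rmult_eq_reg_r (d - b)); lra.
Qed.

Lemma lerp_continuous P Q : cont01 (lerp P Q).
Proof.
move=> t _ eps eps0; case: P Q => [a b] [c d] /=.
(* A Lipschitz constant for both coordinates; the added 1 keeps it positive. *)
set K := Rabs (c - a) + Rabs (d - b) + 1.
have K1 := Rabs_pos (c - a); have K2 := Rabs_pos (d - b).
have K0 : 0 < K by rewrite /K; lra.
exists (eps / K); split; first exact: Rdiv_lt_0_compat.
move=> s _ st.
have bound x y : Rabs (y - x) <= K ->
    Rabs ((1 - s) * x + s * y - ((1 - t) * x + t * y)) < eps.
  move=> xyK.
  have -> : (1 - s) * x + s * y - ((1 - t) * x + t * y) = (s - t) * (y - x).
    by ring.
  rewrite Rabs_mult; apply: (Rle_lt_trans _ (Rabs (s - t) * K)).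
    by apply: Rmult_le_compat_l => //; apply: Rabs_pos.
  have -> : eps = eps / K * K by field; lra.
  exact: Rmult_lt_compat_r.
by split; apply: bound; rewrite /K; lra.
Qed.

Lemma in01_0 : in01 0. Proof. by split; lra. Qed.

(** The vertex [z] ends some edge, and that edge meets [xy] only in a common endpoint. *)
Lemma straight_drawing_vertex (T : finType) (adj : rel T) (pos : T -> R * R)
    (x y z : T) (t : R) :
  (forall z, exists z', adj z z') -> straight_drawing adj pos ->
  adj x y -> in01 t -> lerp (pos x) (pos y) t = pos z -> z = x \/ z = y.
Proof.
move=> noiso [inj cross] xy t01 e.
have [z' zz'] := noiso z.
have [same|diff] := classic ((x = z /\ y = z') \/ (x = z' /\ y = z)).
  by case: same => [[-> _]|[_ ->]]; [left | right].
have [|w [wxy [_ ew]]] := cross _ _ _ _ _ _ xy zz' diff t01 in01_0.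
  by rewrite lerp0.
by have -> : z = w by apply: inj; rewrite -e -ew.
Qed.

Lemma straight_drawing_planar (T : finType) (adj : rel T) (pos : T -> R * R) :
  irreflexive adj -> (forall z, exists z', adj z z') ->
  straight_drawing adj pos -> planar adj.
Proof.
move=> irr noiso draw; have [inj cross] := draw.
have neq x y : adj x y -> pos x <> pos y.
  by move=> xy /inj e; move: xy; rewrite e irr.
exists pos, (fun x y => lerp (pos x) (pos y)); split=> //; split=> // x y xy.
split; first exact: lerp_continuous.
split; first by move=> s t _ _; apply/lerp_inj/neq.
split; first exact: lerp0.
split; first exact: lerp1.
split=> [t _|t z t01 e]; first exact: lerp_sym.
have t01' : in01 t by split; lra.
have [zx|zy] := straight_drawing_vertex noiso draw xy t01' e.
  have : t = 0 by apply: (lerp_inj (neq _ _ xy)); rewrite lerp0 e zx.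
  lra.
have : t = 1 by apply: (lerp_inj (neq _ _ xy)); rewrite lerp1 e zy.
lra.
Qed.

(** * A computable crossing test for integer coordinates *)

Definition int_pos (T : Type) (p : T -> Z * Z) (x : T) : R * R :=
  (IZR (p x).1, IZR (p x).2).

(** Twice the signed area of the triangle PQX. *)
Definition cross (P Q X : Z * Z) : Z :=
  ((Q.1 - P.1) * (X.2 - P.2) - (Q.2 - P.2) * (X.1 - P.1))%Z.

(* The edge uv lies weakly on one side of the line xy and meets it at most in
   an endpoint shared with xy. *)
Definition one_sided (T : eqType) (p : T -> Z * Z) (x y u v : T) : bool :=
  let s := cross (p x) (p y) (p u) in let t := cross (p x) (p y) (p v) in
  [|| Z.ltb 0 (s * t)%Z,
      [&& Z.eqb s 0, ~~ Z.eqb t 0 & (u == x) || (u == y)] |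
      [&& Z.eqb t 0, ~~ Z.eqb s 0 & (v == x) || (v == y)]].

(** The signed area over [xy] is affine along [uv] and vanishes where they meet. This excludes equal
    strict signs at [u] and [v], and otherwise forces [t] to be 0 or 1. *)
Lemma one_sided_common (T : eqType) (p : T -> Z * Z) (x y u v : T) (s t : R) :
  one_sided p x y u v -> in01 t ->
  lerp (int_pos p x) (int_pos p y) s = lerp (int_pos p u) (int_pos p v) t ->
  exists z, (z = x \/ z = y) /\ (z = u \/ z = v)
            /\ lerp (int_pos p x) (int_pos p y) s = int_pos p z.
Proof.
move=> side [t0 t1] e.
have zero : (1 - t) * IZR (cross (p x) (p y) (p u))
          + t * IZR (cross (p x) (p y) (p v)) = 0.
  move: e; rewrite /lerp /int_pos /cross /= => -[e1 e2].
  rewrite !minus_IZR !mult_IZR !minus_IZR.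
  set a := IZR (p x).1 in e1 *; set b := IZR (p x).2 in e2 *.
  set c := IZR (p y).1 in e1 *; set d := IZR (p y).2 in e2 *.
  set g := IZR (p u).1 in e1 *; set h := IZR (p u).2 in e2 *.
  set k := IZR (p v).1 in e1 *; set l := IZR (p v).2 in e2 *.
  have -> : (1 - t) * ((c - a) * (h - b) - (d - b) * (g - a)) +
            t * ((c - a) * (l - b) - (d - b) * (k - a)) =
            (c - a) * ((1 - t) * h + t * l - b)
            - (d - b) * ((1 - t) * g + t * k - a) by ring.
  by rewrite -e1 -e2; ring.
rewrite e; move: side zero; rewrite /one_sided.
set S := cross _ _ (p u); set T' := cross _ _ (p v).
have nz z : ~~ Z.eqb z 0 -> IZR z <> 0.
  by move=> /negP h e0; apply: h; apply/Z.eqb_eq; apply: eq_IZR.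
case/or3P=> [/Z.ltb_lt/IZR_lt|/and3P[/Z.eqb_eq -> /nz h uxy]
            |/and3P[/Z.eqb_eq -> /nz h vxy]].
- rewrite mult_IZR => pos0 zero; exfalso.
  have [S0|S0] := Rle_lt_dec (IZR S) 0.
    have S1 : IZR S < 0 by case: S0 => // S0; rewrite S0 in pos0; lra.
    have T1 : IZR T' < 0 by nra.
    nra.
  have T1 : 0 < IZR T' by nra.
  nra.
- move=> zero; have -> : t = 0 by apply: (Rmult_eq_reg_r (IZR T')) => //; lra.
  by exists u; split; [case/orP: uxy => /eqP; auto | rewrite lerp0; auto].
- move=> zero; have -> : t = 1.
    suff : 1 - t = 0 by lra.
    by apply: (Rmult_eq_reg_r (IZR S)) => //; lra.
  by exists v; split; [case/orP: vxy => /eqP; auto | rewrite lerp1; auto].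
Qed.

Lemma one_sided_straight_drawing (T : finType) (adj : rel T) (p : T -> Z * Z) :
  injective p ->
  (forall x y u v, adj x y -> adj u v ->
     [|| one_sided p x y u v, one_sided p u v x y, (x == u) && (y == v) |
         (x == v) && (y == u)]) ->
  straight_drawing adj (int_pos p).
Proof.
move=> inj sides; split=> [x y [/eq_IZR e1 /eq_IZR e2]|x y u v s t xy uv].
  by apply: inj; rewrite (surjective_pairing (p x)) e1 e2 -surjective_pairing.
move=> diff s01 t01 e; have := sides _ _ _ _ xy uv.
case/or4P=> [side|side|/andP[/eqP ? /eqP ?]|/andP[/eqP ? /eqP ?]].
- exact: one_sided_common side t01 e.
- have [z [zuv [zxy ez]]] := one_sided_common side s01 (esym e).
  by exists z; rewrite e.
- by case: diff; left.
- by case: diff; right.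
Qed.

(** * Needles: drawing a rooted product *)

(** Twice the area of ABP is an integer of absolute value at most 2/4 + 2/12 < 1, so P is on the
    line AB; its height, off by less than 1, stays between those of A and B. *)
Lemma near_segment (A B P : Z * Z) (N mx my t : R) :
  1 <= N ->
  Rabs (IZR (B.1 - A.1)) <= 2 * N -> Rabs (IZR (B.2 - A.2)) <= 2 * N ->
  A.2 <> B.2 -> Rabs mx * N <= 1 / 4 -> Rabs my * N <= 1 / 12 -> in01 t ->
  (IZR P.1 + mx, IZR P.2 + my)
    = lerp (IZR A.1, IZR A.2) (IZR B.1, IZR B.2) t ->
  exists2 t', in01 t' &
    lerp (IZR A.1, IZR A.2) (IZR B.1, IZR B.2) t' = (IZR P.1, IZR P.2).
Proof.
case: A B P => [xa ya] [xb yb] [xi yi] /= N1 dx dy yab hx hy [t0 t1] [e1 e2].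
have az : (cross (xa, ya) (xb, yb) (xi, yi) = 0)%Z.
  suff : Rabs (IZR (cross (xa, ya) (xb, yb) (xi, yi))) < 1.
    move/Rabs_def2=> [h1 h2].
    have h3 := lt_IZR _ 1 h1.
    have h4 : (-1 < cross (xa, ya) (xb, yb) (xi, yi))%Z by apply: lt_IZR; lra.
    lia.
  have -> : IZR (cross (xa, ya) (xb, yb) (xi, yi))
    = - (IZR (xb - xa) * my) + IZR (yb - ya) * mx.
    rewrite /cross /= !minus_IZR !mult_IZR !minus_IZR.
    have -> : IZR xi = (1 - t) * IZR xa + t * IZR xb - mx by lra.
    have -> : IZR yi = (1 - t) * IZR ya + t * IZR yb - my by lra.
    by ring.
  apply: Rle_lt_trans (Rabs_triang _ _) _; rewrite Rabs_Ropp !Rabs_mult.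
  have p1 := Rabs_pos mx; have p2 := Rabs_pos my.
  have : Rabs (IZR (xb - xa)) * Rabs my <= 2 * N * Rabs my.
    exact: Rmult_le_compat_r.
  have : Rabs (IZR (yb - ya)) * Rabs mx <= 2 * N * Rabs mx.
    exact: Rmult_le_compat_r.
  lra.
have my1 : Rabs my < 1 by have := Rabs_pos my; nra.
have [my2 my3] := Rabs_def2 _ _ my1.
have int_le a b : IZR a < IZR b + 1 -> IZR a <= IZR b.
  by rewrite -plus_IZR => /lt_IZR h; apply: IZR_le; lia.
have yr : IZR ya <= IZR yi <= IZR yb \/ IZR yb <= IZR yi <= IZR ya.
  by have [le|lt] := Rle_lt_dec (IZR ya) (IZR yb); [left | right];
    split; apply: int_le; nra.
have yab' : IZR yb - IZR ya <> 0.
  by move=> h; apply: yab; apply: eq_IZR; lra.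
exists ((IZR yi - IZR ya) / (IZR yb - IZR ya)).
  have inv : / (IZR yb - IZR ya) * (IZR yb - IZR ya) = 1 by apply: Rinv_l.
  rewrite /in01 /Rdiv; case: yr => yr; split.
  - by apply: Rmult_le_pos; [lra | apply/Rlt_le/Rinv_0_lt_compat; lra].
  - by apply: (Rmult_le_reg_r (IZR yb - IZR ya)); [|rewrite Rmult_assoc inv]; lra.
  - have := Rinv_lt_0_compat (IZR yb - IZR ya); nra.
  - have := Rinv_lt_0_compat (IZR yb - IZR ya); nra.
have := f_equal IZR az.
rewrite /cross /= !minus_IZR !mult_IZR !minus_IZR /lerp /= => az'.
congr pair; last by field.
apply: (Rmult_eq_reg_r (IZR yb - IZR ya)) => //.
have -> : ((1 - (IZR yi - IZR ya) / (IZR yb - IZR ya)) * IZR xa +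
   (IZR yi - IZR ya) / (IZR yb - IZR ya) * IZR xb) * (IZR yb - IZR ya)
  = (IZR yb - IZR ya) * IZR xa + (IZR yi - IZR ya) * (IZR xb - IZR xa).
  by field.
lra.
Qed.

Lemma Rabs_le_inv (x a : R) : Rabs x <= a -> - a <= x <= a.
Proof. by split_Rabs; lra. Qed.

(* The copy of the drawing attached at P is squashed into a thin needle going
   horizontally to the right of P: no edge of the base drawing is horizontal,
   and no two of its vertices have the same height. *)
Definition needle_pos (T : Type) (p : T -> Z * Z) (N : R) (q : T * T) : R * R :=
  (IZR (p q.1).1 + / (4 * N ^ 2) * IZR (p q.2).2,
   IZR (p q.1).2 + / (12 * N ^ 4) * IZR (p q.2).1).

(** The root at the origin makes a copy start exactly at its base vertex, positive heights point the
    needle to the right, and distinct heights keep needles apart. *)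
Definition flat_drawing (T : finType) (adj : rel T) (r : T) (p : T -> Z * Z)
    (N : R) : Prop :=
  [/\ straight_drawing adj (int_pos p), p r = (0, 0)%Z,
      forall x, x <> r -> (0 < (p x).2)%Z,
      injective (fun x => (p x).2) &
      1 <= N /\ forall x, Rabs (IZR (p x).1) <= N /\ IZR (p x).2 <= N].

(** The factors meet the bounds 1/4 and 1/12 of [near_segment], and their ratio makes needles
    flatter than every base edge. *)
Lemma needle_scale N : 1 <= N ->
  [/\ 0 < / (4 * N ^ 2), 0 < / (12 * N ^ 4),
      / (4 * N ^ 2) * N ^ 2 = 1 / 4 & / (12 * N ^ 4) * N ^ 4 = 1 / 12].
Proof.
move=> N1; have N2 : 0 < N ^ 2 by apply: pow_lt; lra.
have N4 : 0 < N ^ 4 by apply: pow_lt; lra.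
by split; [apply: Rinv_0_lt_compat; lra | apply: Rinv_0_lt_compat; lra
          | field; lra | field; lra].
Qed.

Lemma needle_lerp (T : Type) (p : T -> Z * Z) (N : R) (i j j' : T) (t : R) :
  lerp (needle_pos p N (i, j)) (needle_pos p N (i, j')) t
  = (IZR (p i).1 + / (4 * N ^ 2) * (lerp (int_pos p j) (int_pos p j') t).2,
     IZR (p i).2 + / (12 * N ^ 4) * (lerp (int_pos p j) (int_pos p j') t).1).
Proof. by rewrite /lerp /needle_pos /=; congr pair; ring. Qed.

Lemma needle_base (T : finType) (adj : rel T) (r : T) (p : T -> Z * Z) (N : R)
    (i : T) :
  flat_drawing adj r p N -> needle_pos p N (i, r) = int_pos p i.
Proof.
by case=> _ pr _ _ _; rewrite /needle_pos /int_pos /= pr /=; congr pair; ring.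
Qed.

(** Vertices other than the root have integer height at least 1, so all lie in the convex cone |x|
    <= N y with tip at the root; edges inherit this. *)
Lemma flat_lerp_bounds (T : finType) (adj : rel T) (r : T) (p : T -> Z * Z)
    (N : R) (j j' : T) (t : R) :
  flat_drawing adj r p N -> in01 t ->
  let X := lerp (int_pos p j) (int_pos p j') t in
  [/\ 0 <= X.2, X.2 <= N, Rabs X.1 <= N * X.2 & Rabs X.1 <= N ^ 2].
Proof.
move=> [_ pr pos _ [N1 bd]] t01 X.
have pt x : [/\ 0 <= IZR (p x).2, IZR (p x).2 <= N,
    - (N * IZR (p x).2) <= IZR (p x).1 & IZR (p x).1 <= N * IZR (p x).2].
  have [b1 b2] := bd x; have [xr|xr] := eqVneq x r.
    by rewrite xr pr /=; split; lra.
  have := pos x (elimN eqP xr); move/Zlt_le_succ/IZR_le => /= y1.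
  have [h1 h2] := (Rle_abs (IZR (p x).1), Rle_abs (- IZR (p x).1)).
  rewrite Rabs_Ropp in h2.
  by split; nra.
have [a1 a2 a3 a4] := pt j; have [b1 b2 b3 b4] := pt j'.
have [t0 t1] := t01.
have X0 : 0 <= X.2 by rewrite /X /lerp /=; nra.
have XN : X.2 <= N by rewrite /X /lerp /=; nra.
have XA : Rabs X.1 <= N * X.2.
  by apply: Rabs_le; rewrite /X /lerp /int_pos /=; split; nra.
split=> //; apply: Rle_trans XA _.
by have := @Rmult_le_compat_l N X.2 N; nra.
Qed.

Lemma flat_lerp_root (T : finType) (adj : rel T) (r : T) (p : T -> Z * Z)
    (N : R) (j j' : T) (t : R) :
  flat_drawing adj r p N -> in01 t ->
  (lerp (int_pos p j) (int_pos p j') t).2 = 0 -> r = j \/ r = j'.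
Proof.
move=> [_ pr pos _ _] [t0 t1]; rewrite /lerp /= => e.
have [jr|/eqP jr] := eqVneq j r; first by left.
have [jr'|/eqP jr'] := eqVneq j' r; first by right.
have /IZR_lt h1 := pos j jr; have /IZR_lt h2 := pos j' jr'.
by exfalso; nra.
Qed.

(** A base edge at [i] has slope at least 1/(2N) in absolute value, while the needle stays within a
    smaller slope as seen from [i]. *)
Lemma needle_meets_incident_edge (T : finType) (adj : rel T) (r : T)
    (p : T -> Z * Z) (N : R) (i b j j' : T) (s t : R) :
  flat_drawing adj r p N -> i <> b -> in01 s -> in01 t ->
  lerp (int_pos p i) (int_pos p b) s
    = lerp (needle_pos p N (i, j)) (needle_pos p N (i, j')) t ->
  (r = j \/ r = j') /\ lerp (int_pos p i) (int_pos p b) s = int_pos p i.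
Proof.
move=> flat ib s01 t01 e.
have [X0 XN XA _] := flat_lerp_bounds j j' flat t01.
have rootX := flat_lerp_root flat t01.
have [_ _ _ injy [N1 bd]] := flat.
move: e rootX X0 XN XA; rewrite needle_lerp.
set X := lerp (int_pos p j) _ t => e rootX X0 XN XA.
have [e0 d0 eN dN] := needle_scale N1; move: e e0 d0 eN dN.
set ep := / _; set de := / _ => -[e1 e2] e0 d0 eN dN.
have [s0 s1] := s01.
have dy : 1 <= Rabs (IZR (p b).2 - IZR (p i).2).
  rewrite -minus_IZR -abs_IZR; apply: IZR_le.
  by have : (p b).2 <> (p i).2 by [move/injy/esym]; lia.
have dx : Rabs (IZR (p b).1 - IZR (p i).1) <= 2 * N.
  have [h1 _] := bd b; have [h2 _] := bd i.
  have := Rabs_triang (IZR (p b).1) (- IZR (p i).1).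
  by rewrite Rabs_Ropp /Rminus; lra.
have m1 : ep * X.2 = s * (IZR (p b).1 - IZR (p i).1) by move: e1 => /=; lra.
have m2 : de * X.1 = s * (IZR (p b).2 - IZR (p i).2) by move: e2 => /=; lra.
have n1 : ep * X.2 <= s * (2 * N).
  rewrite m1; apply: Rmult_le_compat_l => //.
  by apply: Rle_trans dx; apply: Rle_abs.
have n2 : s <= de * Rabs X.1.
  rewrite -{1}(Rabs_pos_eq de); last lra.
  rewrite -Rabs_mult m2 Rabs_mult (Rabs_pos_eq s) //; nra.
have n3 : s <= de * (N * X.2).
  by apply: Rle_trans n2 _; apply: Rmult_le_compat_l => //; lra.
have n4 : ep * X.2 <= 2 * N * de * N * X.2 by nra.
have deN : 2 * N * de * N < ep.
  apply: (Rmult_lt_reg_r (N ^ 2)); first by apply: pow_lt; lra.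
  have -> : 2 * N * de * N * N ^ 2 = 2 * (de * N ^ 4) by ring.
  lra.
have X20 : X.2 = 0 by nra.
split; first exact: rootX.
have s00 : s = 0 by rewrite X20 in n3; lra.
by rewrite s00 lerp0.
Qed.

(** Needle points are small perturbations of the position of [i], so by [near_segment] that position
    lies on [ab] and [i] is an end of it; the incident case remains. *)
Lemma needle_meets_edge (T : finType) (adj : rel T) (r : T) (p : T -> Z * Z)
    (N : R) (i a b j j' : T) (s t : R) :
  irreflexive adj -> (forall z, exists z', adj z z') ->
  flat_drawing adj r p N -> adj a b -> in01 s -> in01 t ->
  lerp (int_pos p a) (int_pos p b) s
    = lerp (needle_pos p N (i, j)) (needle_pos p N (i, j')) t ->
  [/\ i = a \/ i = b, r = j \/ r = j' &
      lerp (int_pos p a) (int_pos p b) s = int_pos p i].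
Proof.
move=> irr noiso flat ab s01 t01 e.
have nab : a <> b by move=> h; move: ab; rewrite h irr.
suff iab : i = a \/ i = b.
  suff [rj ei] : (r = j \/ r = j') /\
      lerp (int_pos p a) (int_pos p b) s = int_pos p i by split.
  case: iab => h; rewrite -h in nab e *.
    exact: needle_meets_incident_edge flat nab s01 t01 e.
  (* Reverse the edge so that it starts at [i]. *)
  have s01' : in01 (1 - s) by move: s01; rewrite /in01; lra.
  rewrite lerp_sym in e *.
  exact: needle_meets_incident_edge flat (fun h => nab (esym h)) s01' t01 e.
have [draw pr pos injy [N1 bd]] := flat.
have [X0 XN XA XA2] := flat_lerp_bounds j j' flat t01.
move: e X0 XN XA XA2; rewrite needle_lerp.
set X := lerp (int_pos p j) _ t => e X0 XN XA XA2.
have [e0 d0 eN dN] := needle_scale N1; move: e e0 d0 eN dN.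
set ep := / _; set de := / _ => e e0 d0 eN dN.
have [|||||s' s'01 es'] := near_segment N1 _ _ _ _ _ s01 (esym e).
- by rewrite minus_IZR /=; apply: Rabs_le;
     have /Rabs_le_inv := (bd a).1; have /Rabs_le_inv := (bd b).1; lra.
- rewrite minus_IZR /=; apply: Rabs_le.
  have := (bd a).2; have := (bd b).2.
  have pos' x : 0 <= IZR (p x).2.
    have [->|/eqP/pos/IZR_lt] := eqVneq x r; rewrite ?pr /=; lra.
  by have := pos' a; have := pos' b; lra.
- by move/injy.
- rewrite Rabs_pos_eq; last by nra.
  apply: Rle_trans (_ : ep * N ^ 2 <= _); last lra.
  have -> : ep * X.2 * N = ep * (X.2 * N) by ring.
  by apply: Rmult_le_compat_l; nra.
- rewrite Rabs_mult (Rabs_pos_eq de); last lra.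
  apply: Rle_trans (_ : de * N ^ 4 <= _); last lra.
  have -> : de * Rabs X.1 * N = de * (Rabs X.1 * N) by ring.
  apply: Rmult_le_compat_l; first lra.
  apply: Rle_trans (_ : N ^ 2 * N <= _).
    by apply: Rmult_le_compat_r; lra.
  by have := pow_lt N 3; nra.
exact: (straight_drawing_vertex noiso draw ab s'01 es').
Qed.

Lemma rooted_product_drawing (T : finType) (adj : rel T) (r : T)
    (p : T -> Z * Z) (N : R) :
  irreflexive adj -> (forall z, exists z', adj z z') -> flat_drawing adj r p N ->
  straight_drawing (rooted_product adj r) (needle_pos p N).
Proof.
move=> irr noiso flat; have [[inj cross] pr pos injy [N1 bd]] := flat.
have [e0 d0 eN dN] := needle_scale N1.
(* A needle leaves the height of its base vertex by at most 1/12, and these heights are distinct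
   integers. *)
have apart i i' j j' k k' s t : in01 s -> in01 t ->
    lerp (needle_pos p N (i, j)) (needle_pos p N (i, j')) s
    = lerp (needle_pos p N (i', k)) (needle_pos p N (i', k')) t -> i = i'.
  move=> s01 t01; rewrite !needle_lerp.
  have [_ _ _] := flat_lerp_bounds j j' flat s01.
  have [_ _ _] := flat_lerp_bounds k k' flat t01.
  set X := lerp _ _ s; set Y := lerp _ _ t => YA XA e.
  have e2 : IZR (p i).2 + / (12 * N ^ 4) * X.1
          = IZR (p i').2 + / (12 * N ^ 4) * Y.1 := f_equal snd e.
  apply: injy; have small Z : Rabs Z <= N ^ 2 ->
      - (1 / 12) <= / (12 * N ^ 4) * Z <= 1 / 12.
    have N24 : N ^ 2 <= N ^ 4 by apply: Rle_pow => //; lia.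
    move=> /Rabs_le_inv ZN; rewrite -dN.
    by split; [rewrite Ropp_mult_distr_r|]; apply: Rmult_le_compat_l; lra.
  have sX := small _ XA; have sY := small _ YA.
  suff : ((p i).2 < (p i').2 + 1 /\ (p i').2 < (p i).2 + 1)%Z by lia.
  by split; apply: lt_IZR; rewrite plus_IZR; lra.
(* A single needle is an injective affine image of the base drawing. *)
have affine i j j' k k' s t :
    lerp (needle_pos p N (i, j)) (needle_pos p N (i, j')) s
    = lerp (needle_pos p N (i, k)) (needle_pos p N (i, k')) t ->
    lerp (int_pos p j) (int_pos p j') s = lerp (int_pos p k) (int_pos p k') t.
  rewrite !needle_lerp; set X := lerp _ _ s; set Y := lerp _ _ t => e.
  have e1 : IZR (p i).1 + / (4 * N ^ 2) * X.2
          = IZR (p i).1 + / (4 * N ^ 2) * Y.2 := f_equal fst e.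
  have e2 : IZR (p i).2 + / (12 * N ^ 4) * X.1
          = IZR (p i).2 + / (12 * N ^ 4) * Y.1 := f_equal snd e.
  rewrite (surjective_pairing X) (surjective_pairing Y); congr pair.
    by apply: (Rmult_eq_reg_l (/ (12 * N ^ 4))); lra.
  by apply: (Rmult_eq_reg_l (/ (4 * N ^ 2))); lra.
have base i := needle_base i flat.
split=> [[i j] [i' j'] e|].
  have := apart i i' j j j' j' 0 0 in01_0 in01_0; rewrite !lerp0 => /(_ e) ii'.
  rewrite -ii' in e *; have := affine i j j j' j' 0 0; rewrite !lerp0.
  by move=> /(_ e) /inj ->.
move=> [i j] [i' j'] [k l] [k' l'] s t; rewrite /rooted_product /=.
case/orP=> [/andP[/eqP <- jj']|/and3P[/eqP -> /eqP -> ii']];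
case/orP=> [/andP[/eqP <- ll']|/and3P[/eqP -> /eqP -> kk']] diff s01 t01 e.
- have ik := apart _ _ _ _ _ _ _ _ s01 t01 e; rewrite -ik in diff e *.
  have e' := affine _ _ _ _ _ _ _ e.
  have [|z [zj [zl ez]]] := cross _ _ _ _ _ _ jj' ll' _ s01 t01 e'.
    by move=> [[? ?]|[? ?]]; apply: diff; [left|right]; split; congr pair.
  exists (i, z); split; first by case: zj => ->; auto.
  split; first by case: zl => ->; auto.
  by rewrite needle_lerp ez.
- have e' := esym e; rewrite !base in e'.
  have [ik rj ei] := needle_meets_edge irr noiso flat kk' t01 s01 e'.
  exists (i, r); split; first by case: rj => <-; auto.
  split; first by case: ik => ->; auto.
  by rewrite -e' ei base.
- have e' := e; rewrite !base in e'.
  have [ki rl ek] := needle_meets_edge irr noiso flat ii' s01 t01 e'.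
  exists (k, r); split; first by case: ki => ->; auto.
  split; first by case: rl => <-; auto.
  by rewrite !base ek.
- rewrite !base in e *.
  have [|z [zi [zk ez]]] := cross _ _ _ _ _ _ ii' kk' _ s01 t01 e.
    by move=> [[? ?]|[? ?]]; apply: diff; [left|right]; split; congr pair.
  exists (z, r); rewrite base; split; first by case: zi => ->; auto.
  by split; first by case: zk => ->; auto.
Qed.

Local Close Scope R_scope.

(** * The drawing of the base graph *)

(* The apex of the block lies on the diagonal, and one path runs across each
   side of the segment from the origin to it. The zigzag [z] keeps
   consecutive path edges from being collinear. *)
Definition block_pos (x : option ('I_5 + 'I_5)) : Z * Z :=
  let k (i : 'I_5) := Z.of_nat (i.+1).*2 in
  let z (i : 'I_5) := Z.of_nat (odd i) in
  match x with
  | None => (22, 22)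
  | Some (inl i) => (11 - k i + z i, 11 + k i + z i)
  | Some (inr i) => (11 + k i + z i, 11 - k i + z i)
  end%Z.

(* Doubling the heights and lowering the left block by one makes all heights
   distinct. *)
Definition base_pos (x : option (option ('I_5 + 'I_5) + option ('I_5 + 'I_5))) :
    Z * Z :=
  match x with
  | None => (0, 0)
  | Some (inl a) => ((block_pos a).1, 2 * (block_pos a).2)
  | Some (inr a) => (- (block_pos a).1, 2 * (block_pos a).2 - 1)
  end%Z.

(** Explicit vertex lists let [vm_compute] evaluate the finite checks. *)
Definition apex_enum (T : Type) (s : seq T) : seq (option (T + T)) :=
  None :: [seq Some (inl x) | x <- s] ++ [seq Some (inr x) | x <- s].

Lemma mem_apex_enum (T : eqType) (s : seq T) :
  (forall x, x \in s) -> forall x, x \in apex_enum s.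
Proof.
move=> all_s [[x|x]|] //; rewrite inE mem_cat; apply/orP; right; apply/orP.
  by left; apply: map_f.
by right; apply: map_f.
Qed.

Definition path_enum : seq 'I_5 :=
  [:: @Ordinal 5 0 isT; @Ordinal 5 1 isT; @Ordinal 5 2 isT; @Ordinal 5 3 isT;
      @Ordinal 5 4 isT].

Lemma mem_path_enum (i : 'I_5) : i \in path_enum.
Proof. by case: i => [[|[|[|[|[|]]]]] hi]. Qed.

Definition base_enum := apex_enum (apex_enum path_enum).

Lemma mem_base_enum x : x \in base_enum.
Proof. exact/mem_apex_enum/mem_apex_enum/mem_path_enum. Qed.

Notation base_adj := (apex (apex (path_adj 5))).

Lemma base_no_isolated x : exists y, base_adj x y.
Proof.
by case: x => [[x|x]|]; [exists None | exists None | exists (Some (inl None))].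
Qed.

Lemma base_pos_sides x y u v : base_adj x y -> base_adj u v ->
  [|| one_sided base_pos x y u v, one_sided base_pos u v x y,
      (x == u) && (y == v) | (x == v) && (y == u)].
Proof.
pose edges := [seq e <- [seq (x, y) | x <- base_enum, y <- base_enum]
              | base_adj e.1 e.2].
have edgesP a b : base_adj a b -> (a, b) \in edges.
  move=> ab; rewrite mem_filter; apply/andP; split=> //.
  by apply/allpairsP; exists (a, b); rewrite !mem_base_enum.
have : all (fun e => all (fun e' =>
    [|| one_sided base_pos e.1 e.2 e'.1 e'.2,
        one_sided base_pos e'.1 e'.2 e.1 e.2,
        (e.1 == e'.1) && (e.2 == e'.2) | (e.1 == e'.2) && (e.2 == e'.1)])
    edges) edges by vm_compute.
by move=> /allP chk /edgesP/chk/allP chk' /edgesP/chk'.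
Qed.

(** The bound 44 is the largest height, reached by the apex of the right block at (22, 44). *)
Lemma base_flat_drawing : flat_drawing base_adj None base_pos 44.
Proof.
have inj : injective (fun x => (base_pos x).2).
  move=> x y e; apply/eqP.
  have : all (fun x => all (fun y =>
      Z.eqb (base_pos x).2 (base_pos y).2 ==> (x == y)) base_enum) base_enum.
    by vm_compute.
  move=> /allP/(_ x (mem_base_enum x))/allP/(_ y (mem_base_enum y)).
  by move/implyP; apply; apply/Z.eqb_eq.
split=> //.
- apply: one_sided_straight_drawing => [x y e|]; last exact: base_pos_sides.
  by apply: inj; rewrite e.
- move=> x /eqP xr; apply/Z.ltb_lt.
  have : all (fun x => (x != None) ==> Z.ltb 0 (base_pos x).2) base_enum
    by vm_compute.
  by move=> /allP/(_ x (mem_base_enum x)); rewrite xr.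
- split=> [|x]; first lra.
  have : all (fun x => [&& Z.leb (-44) (base_pos x).1, Z.leb (base_pos x).1 44
                         & Z.leb (base_pos x).2 44]) base_enum by vm_compute.
  move=> /allP/(_ x (mem_base_enum x)).
  move=> /and3P[/Z.leb_le h1 /Z.leb_le h2 /Z.leb_le h3].
  by split; [apply: Rabs_le; split; rewrite -?opp_IZR |]; apply: IZR_le.
Qed.

Theorem mainTheorem13 :
  exists (T : finType) (adj : rel T),
    simple_graph adj /\ planar adj /\ chi2_eq adj 20.
Proof.
(* [O] needs 4 + 4 + 1 = 9 colours, an odd number, which gives 20 = 9 + 9 + 2. *)
pose O := apex (path_adj 5).
have simO : simple_graph O by apply/simple_apex/simple_path.
have simB := simple_apex simO.
have simG := simple_rooted_product None simB.
exists _, (rooted_product (apex O) None); split=> //.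
split.
  apply: straight_drawing_planar (simG.2) _ _; last first.
    exact: rooted_product_drawing simB.2 base_no_isolated base_flat_drawing.
  move=> [i j]; have [j' jj'] := base_no_isolated j.
  by exists (i, j'); rewrite /rooted_product /= eqxx jj'.
have [symH irrH] := tromp_adj_simple.
(* A path vertex sees the two apices above it and its predecessor: a clique of size at most 3. *)
have colO : clique_colorable tromp_adj tromp_sign 1 O.
  apply: (apex_clique_colorable symH tromp_sign_sym).
    by move=> cs szcs; apply: tromp_extendable; apply: leq_trans szcs _.
  exact: path_clique_colorable symH tromp_sign_sym tromp_extendable.
have hom20 sg : symmetric sg -> hom_to_order (rooted_product (apex O) None) sg 20.
  move=> symsg.
  have [f homf] :=
    rooted_product_hom (ord0, true) symH tromp_sign_sym simO colO symsg.
  have -> : 20 = #|{: 'I_10 * bool}| by rewrite card_prod card_ord card_bool.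
  exact: signified_hom_to_order tromp_adj_simple tromp_sign_sym homf.
split=> [sg symsg|]; first exact: chi2_sig_exists (hom20 sg symsg).
exists (rooted_product_sign (apex_sign (apex_sign (path_sign 5)))).
have symsg := rooted_product_sign_sym
  (apex_sign_sym (apex_sign_sym (@path_sign_sym 5))).
split=> //; split=> [|m]; first exact: hom20.
exact: rooted_product_uses_colors (apex_uses_colors path_uses_colors).
Qed.
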